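(* Let $n\ge 4$ be an integer and let $QD_{2^n}=\langle a,b : a^{2^{n-1}}=b^2=1,\ bab^{-1}=a^{2^{n-2}-1}\rangle$ be the quasidihedral group of order $2^n$. Let $\Gamma_{QD_{2^n}}$ be its non-commuting graph. Then the spectrum of the distance matrix $D(\Gamma_{QD_{2^n}})$ (eigenvalues counted with multiplicity, multiplicities being added if two of the listed values coincide) consists of: (a) $-2$ with multiplicity $3\cdot 2^{n-2}-3$; (b) $0$ with multiplicity $2^{n-2}-1$; (c) $3(2^{n-2}-1)+\sqrt{5(2^{n-2})^2-10(2^{n-2})+9}$ and $3(2^{n-2}-1)-\sqrt{5(2^{n-2})^2-10(2^{n-2})+9}$, each with multiplicity $1$.
   Context: For a finite non-abelian group $G$ with centre $Z(G)$, the non-commuting graph $\Gamma_G$ is the simple undirected graph with vertex set $G\setminus Z(G)$, in which two distinct vertices $u,v$ are adjacent if and only if $uv\ne vu$. For a connected graph $H$, $d_{uv}$ denotes the length of a shortest path between vertices $u$ and $v$, and the distance matrix $D(H)$ is the matrix whose $(u,v)$-entry is $d_{uv}$. *)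

(* Defs.v *)
From mathcomp Require Import all_boot all_order all_algebra all_fingroup all_solvable all_field.
Set Implicit Arguments. Unset Strict Implicit. Unset Printing Implicit Defensive.
Import GRing.Theory Num.Theory.

Section NonCommutingGraph.
Variable gT : finGroupType.
Local Open Scope group_scope.

Definition nc_vertices (G : {set gT}) : {set gT} := G :\: 'Z(G).

(* adjacency of the non-commuting graph: distinct vertices u,v with uv <> vu
   (uv <> vu already forces u <> v) *)
Definition nc_adj (G : {set gT}) : rel gT :=
  fun x y => [&& x \in nc_vertices G, y \in nc_vertices G & x * y != y * x].
End NonCommutingGraph.

Section GraphDistance.
Variable T : finType.

Definition reach (e : rel T) (u : T) (k : nat) : {set T} :=
  iter k (fun S : {set T} => [set y | [exists x in S, e x y]]) [set u].

(* shortest-path distance: least k such that v is reachable from u in k steps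
   (any shortest path has at most #|T| - 1 edges, so searching k < #|T|
   suffices; the value #|T| is returned only if v is unreachable, which does
   not happen for a connected graph) *)
Definition gdist (e : rel T) (u v : T) : nat :=
  find (fun k => v \in reach e u k) (iota 0 #|T|).
End GraphDistance.

Definition nc_dist_mx (gT : finGroupType) (G : {set gT}) :
    'M[algC]_#|nc_vertices G| :=
  \matrix_(i, j) (gdist (nc_adj G)
                    (enum_val i) (enum_val j))%:R%R.

(* Main.v *)
Require Import Defs.
From mathcomp Require Import all_boot all_order all_algebra all_fingroup all_solvable all_field ring zify.
Import GRing.Theory Num.Theory.
Local Open Scope ring_scope.

(* In a non-abelian group G with an abelian subgroup A of index 2, commuting
   is an equivalence relation off the centre Z; its classes are A \ Z and the
   cosets of Z outside A.  So the non-commuting graph is complete multipartite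
   and has diameter 2: with U the incidence matrix of vertices and parts and J
   the all-ones matrix, D + 2 I = U (I + J) U^T.  Sylvester's determinant
   identity reduces the characteristic polynomial to the determinant of a
   diagonal matrix minus a rank-one matrix, indexed by the parts.  In QD_{2^n},
   A = <a> and |Z| = 2. *)

(** * Determinants and complete multipartite distance matrices *)

(** Sylvester's identity without dividing by [y]: the determinant of one block matrix [M] is
    computed by clearing its lower left block from the right ([eL]) and from the left ([eR]). *)
Lemma det_sub_mulmxC {R : comNzRingType} {p q} (y : R)
    (A : 'M_(p, q)) (B : 'M_(q, p)) :
  y ^+ q * \det (y%:M - A *m B) = y ^+ p * \det (y%:M - B *m A).
Proof.
pose M := block_mx y%:M A B 1%:M.
have eL : M *m block_mx 1%:M 0 (- B) 1%:M = block_mx (y%:M - A *m B) A 0 1%:M.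
  rewrite mulmx_block !mulmx1 !mulmx0 !mul1mx mulmxN add0r add0r.
  by rewrite subrr.
have eR : block_mx 1%:M 0 (- B) y%:M *m M = block_mx y%:M A 0 (y%:M - B *m A).
  rewrite mulmx_block !mul1mx !mul0mx !addr0 mulmx1 mulNmx.
  rewrite scalar_mxC addNr.
  by rewrite mulNmx addrC.
have := congr1 determinant eL; have := congr1 determinant eR.
rewrite !det_mulmx !det_ublock !det_lblock !det1 !det_scalar !mul1r !mulr1.
by move=> <- <-.
Qed.

(** The matrix determinant lemma with denominators cleared: the bordered matrix [M] is reduced by
    two column operations, the second of which costs a factor [p] that is then cancelled. *)
Lemma det_diag_sub_rank1 {R : idomainType} {n} (d : 'rV[R]_n)
    (c : 'cV_n) (r : 'rV_n) :
  (forall i, d 0 i != 0) ->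
  \det (diag_mx d - c *m r) =
    \prod_i d 0 i - \sum_i r 0 i * c i 0 * \prod_(j | j != i) d 0 j.
Proof.
move=> d_neq0; set p := \prod_i d 0 i; set s := \sum_i _.
have p_neq0 : p != 0 by apply/prodf_neq0.
pose M := block_mx 1%:M r c (diag_mx d).
have detM : \det M = \det (diag_mx d - c *m r).
  have : M *m block_mx 1%:M (- r) 0 1%:M
       = block_mx 1%:M 0 c (diag_mx d - c *m r).
    rewrite mulmx_block !mulmx1 !mulmx0 !mul1mx mulmxN !addr0 addNr.
    by rewrite addrC.
  move/(congr1 determinant).
  by rewrite det_mulmx det_ublock det_lblock !det1 !mul1r mulr1.
rewrite -detM; apply: (mulIf p_neq0).
(* This is [p] times the solution [x] of [diag_mx d *m x = c], written without inverses. *)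
pose e := \col_i (c i 0 * \prod_(j | j != i) d 0 j).
have : M *m block_mx p%:M 0 (- e) 1%:M
     = block_mx (p - s)%:M r 0 (diag_mx d).
  rewrite mulmx_block !mulmx1 !mulmx0 !mul1mx !mulmxN !add0r; congr block_mx.
    rewrite raddfB; congr (_ - _); rewrite [LHS]mx11_scalar !mxE; congr _%:M.
    by apply: eq_bigr => i _; rewrite !mxE mulrA.
  apply/matrixP=> i j; rewrite mul_mx_scalar mul_diag_mx !mxE ord1.
  by rewrite /p (bigD1 i) //= mulrCA mulrC mulrA subrr.
move/(congr1 determinant).
by rewrite det_mulmx det_ublock det_lblock det1 mulr1 !det_scalar1 det_diag.
Qed.


(** The entries of [D] are 0 on the diagonal, 2 inside a part and 1 across parts, so adding 2 on the
    diagonal leaves 1 plus the indicator of a common part. *)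
Lemma char_poly_multipartite {R : idomainType} {J : finType} {N}
    (f : 'I_N -> J) (P : {set J}) (D : 'M[R]_N) :
  (forall i, f i \in P) ->
  (forall i j, D i j = ((i != j) * (f i == f j).+1)%:R) ->
  let Y : {poly R} := 'X + 2%:P in
  let s c := #|[set i | f i == c]|%:R in
  Y ^+ #|P| * char_poly D =
    Y ^+ N * (\prod_(c in P) (Y - s c)
              - \sum_(c in P) s c * \prod_(c' in P | c' != c) (Y - s c')).
Proof.
move=> fP D_E Y s.
pose U : 'M[{poly R}]_(N, #|P|) := \matrix_(i, c) (f i == enum_val c)%:R.
(* [W] is (I + J) U^T: each row of [U] has a single 1, so J U^T is all ones. *)
pose W := U^T + const_mx 1.
have sumU (F : 'I_#|P| -> {poly R}) i :
    \sum_c (f i == enum_val c)%:R * F c = F (enum_rank_in (fP i) (f i)).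
  rewrite (bigD1 (enum_rank_in (fP i) (f i))) //= enum_rankK_in // eqxx mul1r.
  rewrite big1 ?addr0 // => c ne_c; case: eqP => [e|]; last by rewrite mul0r.
  by case/eqP: ne_c; apply: enum_val_inj; rewrite enum_rankK_in.
have -> : char_poly D = \det (Y%:M - U *m W).
  congr (\det _); apply/matrixP=> i j; rewrite !mxE.
  under eq_bigr do rewrite !mxE.
  rewrite sumU enum_rankK_in // D_E (eq_sym (f j)).
  have [->|_] := eqVneq i j; first by rewrite eqxx mul0n /Y !polyC_natr /= !mulr1n; ring.
  by rewrite mul1n !mulr0n !sub0r polyC_natr -addn1 natrD.
have sE c : \sum_i (f i == enum_val c)%:R = s (enum_val c) :> {poly R}.
  by rewrite /s -sum1dep_card natr_sum [RHS]big_mkcond; apply: eq_bigr => i _;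
    case: eqP.
rewrite det_sub_mulmxC; congr (_ * _).
(* U^T U is diagonal with the part sizes, and the all-ones matrix times [U] repeats the row of part
   sizes, which is the rank-one term. *)
have -> : Y%:M - W *m U = diag_mx (\row_c (Y - s (enum_val c)))
    - const_mx 1 *m \row_c s (enum_val c).
  rewrite /W mulmxDl opprD addrA; congr (_ - _).
    apply/matrixP=> c c'; rewrite !mxE -sE.
    under eq_bigr do rewrite !mxE.
    have [->|ne] := eqVneq c c'.
      rewrite !mulr1n; congr (_ - _); apply: eq_bigr => i _.
      by case: eqP; rewrite ?mulr1 ?mulr0.
    rewrite !mulr0n big1 ?subr0 // => i _.
    case: eqP => [->|]; last by rewrite mul0r.
    by rewrite (inj_eq enum_val_inj) (negPf ne) mulr0.
  apply/matrixP=> c c'; rewrite !mxE big_ord1 !mxE mul1r -sE.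
  by apply: eq_bigr => i _; rewrite !mxE mul1r.
rewrite det_diag_sub_rank1 => [|c]; last first.
  by rewrite mxE /Y /s -addrA -polyC_natr -polyCB monic_neq0 ?monicXaddC.
rewrite [in RHS]big_enum_val [X in _ = _ - X]big_enum_val; congr (_ - _).
  by apply: eq_bigr => c _; rewrite mxE.
apply: eq_bigr => c _; rewrite !mxE mulr1; congr (_ * _).
rewrite [RHS]big_enum_val_cond; apply: eq_big => [c'|c' _]; last by rewrite mxE.
by rewrite (inj_eq enum_val_inj).
Qed.

(** * Fibre counting and short graph distances *)

Lemma card_enum_val_preim {T : finType} {A B : {set T}} :
  B \subset A -> #|[set i : 'I_#|A| | enum_val i \in B]| = #|B|.
Proof.
move=> sBA; rewrite -(card_imset _ enum_val_inj); apply: eq_card => x.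
apply/imsetP/idP=> [[i] | Bx]; first by rewrite inE => Bi ->.
have Ax := subsetP sBA x Bx.
by exists (enum_rank_in Ax x); rewrite ?inE enum_rankK_in.
Qed.

Lemma gdist_adj {T : finType} (e : rel T) (u v : T) :
  u != v -> e u v -> gdist e u v = 1%N.
Proof.
move=> ne_uv uv; have : (1 < #|T|)%N by apply/card_gt1P; exists u, v.
rewrite /gdist; case: #|T| => [|[|m]] //= _.
rewrite inE eq_sym (negPf ne_uv) inE.
by case: existsP => // -[]; exists u; rewrite inE eqxx.
Qed.

Lemma gdist_common_neighbour {T : finType} (e : rel T) (u w v : T) :
  u != v -> ~~ e u v -> e u w -> e w v -> gdist e u v = 2%N.
Proof.
move=> ne_uv n_uv uw wv.
(* [gdist] tests only k < [#|T|]; the three vertices are distinct, so k = 2 is among the values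
   tested. *)
have : (2 < #|T|)%N.
  apply/card_gt2P; exists u, w, v; split=> //; split; rewrite ?(eq_sym v) //.
    by apply: contraNneq n_uv => {1}->.
  by apply: contraNneq n_uv => <-.
rewrite /gdist; case: #|T| => [|[|[|m]]] //= _.
rewrite inE eq_sym (negPf ne_uv) !inE.
case: existsP => [[x]|_]; first by rewrite inE => /andP[/eqP->] /(negP n_uv).
case: existsP => // -[]; exists w; rewrite inE wv andbT.
by apply/existsP; exists u; rewrite inE eqxx.
Qed.

(** * Groups with an abelian subgroup of index two *)

Section AbelianIndexTwo.
Variables (gT : finGroupType) (G A : {group gT}).
Hypotheses (sAG : A \subset G) (indexA : #|G : A|%g = 2%N).
Hypotheses (abA : abelian A) (nabG : ~~ abelian G).
Local Open Scope group_scope.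
Local Notation Z := 'Z(G).

Definition nc_part (x : gT) : {set gT} := if x \in A then A :\: Z else Z :* x.

(** G is the union of [A] and [A :* x], and [w] commutes with [x] and with all of the abelian
    [A]. *)
Lemma commute_setD_center {w x} :
  w \in A -> x \in G :\: A -> commute w x -> w \in Z.
Proof.
move=> Aw GAx cwx; apply/centerP; split=> [|y Gy]; first exact: (subsetP sAG).
have [Ay | nAy] := boolP (y \in A); first exact: (centsP abA).
have: y \in A :* x by rewrite (rcoset_index2 sAG indexA GAx) inE nAy.
by case/rcosetP=> a Aa ->; apply: commuteM => //; apply: (centsP abA).
Qed.

(** A central [x] outside [A] would commute with all of [A], making [A] central, hence also [A :* x]
    and so G. *)
Lemma center_sub_abelian_index2 : Z \subset A.
Proof.
apply/subsetP=> x Zx; apply: contraR nabG => nAx.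
have [Gx cGx] := centerP _ _ Zx.
have GAx : x \in G :\: A by rewrite inE nAx.
suffices sGZ : G \subset Z by apply: abelianS sGZ (center_abelian G).
have sAZ : A \subset Z.
  apply/subsetP=> w Aw; apply: commute_setD_center GAx _ => //.
  by apply/commute_sym/cGx/(subsetP sAG).
apply/subsetP=> y Gy; have [Ay | nAy] := boolP (y \in A).
  exact: (subsetP sAZ).
have: y \in A :* x by rewrite (rcoset_index2 sAG indexA GAx) inE nAy.
by case/rcosetP=> a Aa ->; rewrite groupM // (subsetP sAZ).
Qed.

Lemma commute_nc_part u v : u \in nc_vertices G -> v \in nc_vertices G ->
  (u * v == v * u) = (nc_part u == nc_part v).
Proof.
(* By symmetry, the case of [u] outside [A] and [v] inside is dropped. *)
wlog le_uv : u v / (u \notin A) ==> (v \notin A) => [IH Vu Vv|].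
  have [le|] := boolP ((u \notin A) ==> (v \notin A)); first exact: IH.
  by rewrite negb_imply negbK eq_sym [RHS]eq_sym => /andP[_ Av]; apply: IH;
    rewrite ?Av.
move: le_uv; rewrite /nc_part /nc_vertices !in_setD => le_uv /andP[nZu Gu] /andP[nZv Gv].
move: le_uv; have [Au|nAu] /= := boolP (u \in A) => [_|nAv].
  have [Av|nAv] := boolP (v \in A).
    by rewrite eqxx; apply/eqP/(centsP abA).
  have GAv : v \in G :\: A by rewrite inE nAv.
  apply/eqP/eqP=> [/(commute_setD_center Au GAv)|/setP/(_ v)].
    by rewrite (negPf nZu).
  by rewrite rcoset_refl in_setD (negPf nAv) andbF.
rewrite (negPf nAv).
(* With both outside [A], write v = a u: it commutes with u iff a does, iff a is central, iff the
   two cosets of Z agree. *)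
have: v \in A :* u by rewrite (rcoset_index2 sAG indexA) ?inE ?nAu ?nAv.
case/rcosetP=> a Aa ->{v nAv nZv Gv}.
have GAu : u \in G :\: A by rewrite inE nAu.
apply/eqP/eqP=> [cua | eqZ].
  apply/rcoset_eqP; rewrite mem_rcoset invMg mulKVg.
  rewrite groupV; apply: (commute_setD_center Aa GAu).
  by apply: (mulIg u); rewrite -cua mulgA.
have Za : a \in Z.
  have: a * u \in Z :* u by rewrite eqZ rcoset_refl.
  by rewrite mem_rcoset mulgK.
have [_ cGa] := centerP _ _ Za.
by rewrite mulgA (cGa u Gu).
Qed.

Lemma gdist_nc_part u v : A :!=: Z ->
    u \in nc_vertices G -> v \in nc_vertices G ->
  gdist (nc_adj G) u v = ((u != v) * (nc_part u == nc_part v).+1)%N.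
Proof.
move=> neAZ Vu Vv.
have adjE x y : x \in nc_vertices G -> y \in nc_vertices G ->
    nc_adj G x y = (nc_part x != nc_part y).
  by move=> Vx Vy; rewrite /nc_adj Vx Vy -commute_nc_part.
have [->|ne_uv] := eqVneq u v.
  have : (0 < #|gT|)%N by apply/card_gt0P; exists v.
  by rewrite /gdist; case: #|gT| => //= m _; rewrite inE eqxx.
have [e_uv|n_uv] := eqVneq (nc_part u) (nc_part v); last first.
  by rewrite gdist_adj ?adjE.
(* Any vertex of another part is a common neighbour. One exists outside [A] if [u] is in [A], and
   otherwise in [A :\: Z], nonempty by [neAZ]. *)
suffices [w Vw n_uw] : exists2 w, w \in nc_vertices G & nc_part u != nc_part w.
  rewrite (gdist_common_neighbour _ _ w) ?adjE // ?negbK ?e_uv //.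
  by rewrite eq_sym -e_uv.
have sZA := center_sub_abelian_index2.
have [Au|nAu] := boolP (u \in A).
  have /subsetPn[w Gw nAw] : ~~ (G \subset A).
    by apply: contra nabG => sGA; apply: abelianS abA.
  exists w; first by rewrite in_setD Gw (contra (subsetP sZA w)).
  rewrite /nc_part Au (negPf nAw).
  by apply/eqP=> /setP/(_ w); rewrite rcoset_refl in_setD (negPf nAw) andbF.
have /subsetPn[w Aw nZw] : ~~ (A \subset Z).
  by apply: contra neAZ => sAZ; rewrite eqEsubset sAZ.
exists w; first by rewrite in_setD nZw (subsetP sAG).
rewrite /nc_part Aw (negPf nAu).
by apply/eqP=> /setP/(_ u); rewrite rcoset_refl in_setD (negPf nAu) andbF.
Qed.

Let parts : {set {set gT}} := A :\: Z |: rcosets Z (G :\: A).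

Lemma notin_rcosets_center : A :\: Z \notin rcosets Z (G :\: A).
Proof.
apply/rcosetsP=> -[x]; rewrite in_setD => /andP[nAx _] /setP/(_ x).
by rewrite rcoset_refl in_setD (negPf nAx) andbF.
Qed.

(** The cosets of Z in G number twice those in [A]; removing the latter leaves [#|A : Z|]. *)
Lemma card_rcosets_center : #|rcosets Z (G :\: A)| = #|A : Z|.
Proof.
have sZA := center_sub_abelian_index2.
have -> : rcosets Z (G :\: A) = rcosets Z G :\: rcosets Z A.
  apply/setP=> C; rewrite in_setD; apply/rcosetsP/andP.
    case=> x /setDP[Gx nAx] ->; split; last by apply/rcosetsP; exists x.
    apply: contra nAx => /rcosetsP[y Ay] /setP/(_ x).
    rewrite rcoset_refl => /esym/rcosetP[z Zz ->].
    by rewrite groupM // (subsetP sZA).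
  case=> nAC /rcosetsP[x Gx defC]; exists x => //; rewrite in_setD Gx andbT.
  by apply: contra nAC => Ax; apply/rcosetsP; exists x.
rewrite cardsD (setIidPr _) ?imsetS // -/(indexg G Z) -/(indexg A Z).
by rewrite -(Lagrange_index sAG sZA) indexA mul2n -addnn addnK.
Qed.

Lemma nc_part_in x : x \in nc_vertices G -> nc_part x \in parts.
Proof.
case/setDP=> Gx _; rewrite /nc_part /parts in_setU1.
case: ifPn => [_|nAx]; first by rewrite eqxx.
by apply/orP; right; apply/rcosetsP; exists x; rewrite // in_setD nAx.
Qed.

(** Identifies the fibres of [nc_part] with the parts themselves, so that fibre sizes become
    cardinals of parts. *)
Lemma nc_part_eq x c : x \in nc_vertices G -> c \in parts ->
  (nc_part x == c) = (x \in c).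
Proof.
case/setDP=> Gx nZx /setU1P[-> | /rcosetsP[y /setDP[Gy nAy] ->]].
  rewrite in_setD nZx /nc_part; case: ifP => [_|nAx]; first exact: eqxx.
  by apply/eqP=> /setP/(_ x); rewrite rcoset_refl in_setD nAx andbF.
rewrite /nc_part; case: ifPn => [Ax|_].
  transitivity false.
    apply/eqP=> /setP/(_ y).
    by rewrite rcoset_refl in_setD (negPf nAy) andbF.
  apply/esym; apply: contraNF nAy => /rcosetP[z Zz def_x].
  by rewrite -(groupMl y (subsetP center_sub_abelian_index2 z Zz)) -def_x.
by apply/eqP/idP=> [<-|/rcoset_eqP//]; rewrite ?rcoset_refl.
Qed.

Lemma parts_sub c : c \in parts -> c \subset nc_vertices G.
Proof.
have sZA := center_sub_abelian_index2.
case/setU1P=> [-> | /rcosetsP[y /setDP[Gy nAy] ->]]; first exact: setSD.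
apply/subsetP=> _ /rcosetP[z Zz ->].
have Az := subsetP sZA z Zz; have Gz := subsetP sAG z Az.
by rewrite in_setD (contra (subsetP sZA (z * y))) ?groupMl.
Qed.

(** There is one part of size [p] and [m] parts of size [q]. In the rank-one sum the first
    contributes the term without factor [Y - p], and each of the others the same term lacking one
    [Y - q]. *)
Lemma char_poly_nc_dist_mx : A :!=: Z ->
  let Y : {poly algC} := ('X + 2%:P)%R in
  let p := #|A :\: Z|%:R%R in let q := #|Z|%:R%R in let m := #|A : Z| in
  (Y ^+ m.+1 * char_poly (nc_dist_mx G) =
   Y ^+ #|nc_vertices G| *
     ((Y - p) * (Y - q) ^+ m
      - (p * (Y - q) ^+ m + (q * ((Y - p) * (Y - q) ^+ m.-1)) *+ m)))%R.
Proof.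
move=> neAZ Y p q m.
have card_parts : #|parts| = m.+1.
  by rewrite cardsU1 notin_rcosets_center card_rcosets_center.
have nc_partP (i : 'I_#|nc_vertices G|) : nc_part (enum_val i) \in parts.
  exact/nc_part_in/enum_valP.
have dist_E i j : nc_dist_mx G i j =
    ((i != j) * (nc_part (enum_val i) == nc_part (enum_val j)).+1)%:R%R.
  by rewrite mxE gdist_nc_part ?enum_valP // (inj_eq enum_val_inj).
have := char_poly_multipartite _ _ _ nc_partP dist_E.
rewrite card_parts => ->; congr (_ * _)%R.
have card_part c : c \in parts ->
    #|[set i : 'I_#|nc_vertices G| | nc_part (enum_val i) == c]| = #|c|.
  move=> Pc; rewrite -(card_enum_val_preim (parts_sub c Pc)).
  by apply: eq_card => i; rewrite !inE nc_part_eq ?enum_valP.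
under eq_bigr => c Pc do rewrite card_part //.
under [X in (_ - X)%R]eq_bigr => c Pc.
  rewrite card_part //.
  under eq_bigr => c' /andP[Pc' _] do rewrite card_part //.
  over.
have rcosetE c : c \in rcosets Z (G :\: A) -> #|c| = #|Z|.
  by case/rcosetsP=> x _ ->; rewrite card_rcoset.
rewrite !big_setU1 ?notin_rcosets_center //=.
have cardR : #|rcosets Z (G :\: A)| = m by exact: card_rcosets_center.
have prod_const (S : {set {set gT}}) : S \subset rcosets Z (G :\: A) ->
    (\prod_(c in S) (Y - #|c|%:R) = (Y - q) ^+ #|S|)%R.
  move/subsetP=> sS; rewrite -prodr_const.
  by apply: eq_bigr => c /sS/rcosetE ->.
rewrite prod_const // cardR; congr (_ - (_ * _ + _))%R.
  rewrite -cardR -(prod_const _ (subxx _)); apply: eq_bigl => c.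
  rewrite in_setU1; case: eqP => [->|]; last by rewrite andbT.
  by rewrite (negPf notin_rcosets_center).
rewrite -{2}cardR -sumr_const; apply: eq_bigr => c Rc.
rewrite rcosetE //; congr (_ * _)%R.
have nA0 : A :\: Z \notin rcosets Z (G :\: A) :\ c.
  by rewrite in_setD1 (negPf notin_rcosets_center) andbF.
rewrite (eq_bigl (mem (A :\: Z |: rcosets Z (G :\: A) :\ c))) => [|c'].
  rewrite big_setU1 //= prod_const ?subD1set //.
  by rewrite -cardR [in RHS](cardsD1 c) Rc.
rewrite /= !in_setU1 in_setD1.
case: (eqVneq c' c) => [->|_]; rewrite ?andbT // andbF orbF.
by apply/esym/negbTE; apply: contraNneq notin_rcosets_center => <-.
Qed.

End AbelianIndexTwo.

(* G = <a, b> with a^(2^(n-1)) = b^2 = 1, b a b^-1 = a^(2^(n-2)-1), |G| = 2^n,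
   i.e. G is the quasidihedral group QD_{2^n}.  The spectrum of the distance
   matrix (with multiplicities) is encoded by its characteristic polynomial. *)
Theorem theorem4p1 (n : nat) (gT : finGroupType) (G : {group gT}) (a b : gT) :
  (4 <= n)%N ->
  G :=: <<[set a; b]>>%g ->
  (a ^+ (2 ^ n.-1) = 1)%g ->
  (b ^+ 2 = 1)%g ->
  (b * a * b^-1 = a ^+ (2 ^ (n - 2) - 1))%g ->
  #|G| = (2 ^ n)%N ->
  let k : algC := (2 ^ (n - 2))%N%:R in
  char_poly (nc_dist_mx G) =
    ('X + 2%:P) ^+ (3 * 2 ^ (n - 2) - 3)%N * 'X ^+ (2 ^ (n - 2) - 1)%N
    * ('X - (3%:R * (k - 1) + sqrtC (5%:R * k ^+ 2 - 10%:R * k + 9%:R))%:P)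
    * ('X - (3%:R * (k - 1) - sqrtC (5%:R * k ^+ 2 - 10%:R * k + 9%:R))%:P).
Proof.
move=> n_gt3 defG a_q b2 ab oG k.
pose A := <[a]>%G; pose r := (2 ^ (n - 2))%N.
have bV : (b^-1 = b)%g by apply/eqP; rewrite eq_invg_mul; apply/eqP.
have ajb : (a ^ b = a ^+ (2 ^ n.-2).-1)%g.
  by rewrite conjgE bV -{2}bV mulgA ab subn2 subn1.
have oa_le : (#[a]%g <= 2 ^ n.-1)%N.
  by rewrite dvdn_leq ?expn_gt0 // order_dvdn a_q.
have ob_le : (#[b]%g <= 2)%N by rewrite dvdn_leq // order_dvdn b2.
have nAb : (<[b]> \subset 'N(<[a]>))%g.
  by rewrite cycle_subG; apply/normP/eqP; rewrite eqEcard cardJg leqnn andbT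
    -cycleJ ajb cycle_subG mem_cycle.
have joinAb : (<[a]> <*> <[b]>)%g = G :> {set gT}
  by rewrite joing_idl joing_idr joingE defG.
have defAb : G = (<[a]> * <[b]>)%g :> {set gT}.
  by rewrite -joinAb; apply: norm_joinEr.
have pow_n : (2 ^ n.-1 * 2 = 2 ^ n)%N.
  by rewrite -expnSr prednK // (leq_trans _ n_gt3).
have cardAb : (#[a]%g * #[b]%g = 2 ^ n.-1 * 2 * #|<[a]> :&: <[b]>|%g)%N.
  by rewrite pow_n -oG defAb mul_cardG.
(* |a| <= 2^(n-1) and |b| <= 2, so |G| = 2^n forces equality throughout. *)
have [oa ob tiAb] : [/\ #[a]%g = (2 ^ n.-1)%N, #[b]%g = 2%N
                      & #|<[a]> :&: <[b]>|%g = 1%N].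
  move: cardAb oa_le ob_le (order_gt0 a) (order_gt0 b).
  have := cardG_gt0 (<[a]> :&: <[b]>)%G; have : (0 < 2 ^ n.-1)%N by rewrite expn_gt0.
  move: (2 ^ _)%N #[a]%g #[b]%g #|_| => q x y t.
  by case: y => [|[|[|y]]] //; split; nia.
have nAb' : b \notin A.
  apply/negP; rewrite -cycle_subG => /setIidPr sbA.
  by move: tiAb; rewrite sbA -orderE ob.
have Ga : a \in G by rewrite defG mem_gen // !inE eqxx.
have Gb : b \in G by rewrite defG mem_gen // !inE eqxx orbT.
have sAG : A \subset G by rewrite cycle_subG.
(* Matching the presentation of ['SD_(2 ^ n)] gives access to its known structure, from which the
   centre has order 2. *)
have isoG : (G \isog [set: 'SD_(2 ^ n)])%g.
  apply/(isoGrpP _ (Grp_semidihedral n_gt3)); rewrite card_semidihedral //.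
  split=> //; apply/existsP; exists (a, b).
  by rewrite /= a_q b2 ajb joinAb !xpair_eqE !eqxx.
have genG : extremal_generators G 2 n (a, b).
  by split=> //; rewrite in_setD nAb' Gb.
have [_ _ [_ oZ _ _] _ _] := @semidihedral_structure _ _ _ _ _ n_gt3 genG isoG ob.
have indexA : #|G : A|%g = 2%N.
  by rewrite -divgS // oG -orderE oa -pow_n mulKn // expn_gt0.
have oA : #|A| = (2 * r)%N.
  by rewrite -orderE oa -expnS /r; congr (2 ^ _)%N; lia.
have r_gt3 : (3 < r)%N by rewrite /r -(subnKC n_gt3); rewrite (@leq_exp2l 2 2); lia.
have abA : abelian A by apply: cycle_abelian.
have nabG : ~~ abelian G.
  apply/negP=> /center_idP defZ; move: oZ; rewrite defZ oG.
  by rewrite -pow_n -oa orderE -[<[a]>%g]/(gval A) oA; lia.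
have neAZ : A :!=: 'Z(G)%g.
  by apply/eqP=> /(congr1 (fun B : {set gT} => #|B|)); rewrite oZ oA; lia.
have sZA := center_sub_abelian_index2 _ _ _ sAG indexA abA nabG.
have indexZ : #|A : 'Z(G)|%g = r by rewrite -divgS // oA oZ mulKn.
have cardAZ : #|A :\: 'Z(G)%g| = (2 * r - 2)%N.
  by rewrite cardsD (setIidPr sZA) oA oZ.
(* The 4r - 2 vertices are split so that [r.+1], the number of parts, can be cancelled; the rest is
   the multiplicity of -2. *)
have cardV : #|nc_vertices G| = (r.+1 + (3 * r - 3))%N.
  rewrite cardsD (setIidPr (center_sub G)) oG oZ -pow_n -oa orderE.
  by rewrite -[<[a]>%g]/(gval A) oA; lia.
have Y_neq0 : ('X + 2%:P : {poly algC}) ^+ r.+1 != 0.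
  by rewrite expf_neq0 // monic_neq0 ?monicXaddC.
apply: (mulfI Y_neq0).
have := char_poly_nc_dist_mx _ _ _ sAG indexA abA nabG neAZ.
rewrite /=; move: (char_poly _) => chi.
rewrite cardV cardAZ oZ indexZ => ->; rewrite exprD -!mulrA; congr (_ * (_ * _)).
(* Parts of size 2 turn [Y - q] into ['X], the source of the eigenvalue 0. *)
have -> : 'X + 2%:P - 2%:R = 'X :> {poly algC} by rewrite polyC_natr addrK.
have kE : k%:P = r%:R :> {poly algC} by rewrite polyC_natr.
set c := 3%:R * (k - 1); set s := sqrtC _.
have cE : c%:P = 3%:R * (r%:R - 1) :> {poly algC}.
  by rewrite polyCM polyCB kE polyC_natr.
have sE : s%:P ^+ 2 = 5%:R * r%:R ^+ 2 - 10%:R * r%:R + 9%:R :> {poly algC}.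
  rewrite -polyC_exp sqrtCK !polyCD polyCN polyCM polyC_exp polyCM kE.
  by rewrite !polyC_natr.
(* Only the square of [s] remains, so the root disappears; the quadratic is X^2 - 6(r - 1)X + 4r^2 -
   8r. *)
have -> : ('X - (c + s)%:P) * ('X - (c - s)%:P) = ('X - c%:P) ^+ 2 - s%:P ^+ 2.
  by rewrite polyCB polyCD; ring.
rewrite cE sE natrB ?natrM; last by lia.
have r_gt0 : (0 < r)%N by lia.
rewrite -[2%:R * _ *+ r]mulr_natr polyC_natr -/r.
(* Splitting off one ['X] lets the power with exponent r - 1 be abstracted, leaving an identity for
   [ring]. *)
rewrite -[in 'X ^+ r](prednK r_gt0) exprS.
move: (r%:R) => x; rewrite -subn1; move: ('X ^+ (r - 1)) => y.
ring.
Qed.
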